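(* Let $P$ be a partial latin square of order $n$. For each $\sigma\in\{1,\dots,n\}$ let $\nu(\sigma)$ be the number of times $\sigma$ appears in $P$, and for each empty cell $b$ of $P$ let $S(b)$ be the set of symbols supported by $b$. Suppose that \[\sum_{\sigma\in S(b)}\frac{1}{n-\nu(\sigma)}\ge 1\quad\text{for each empty cell } b \text{ of } P.\] Then $P$ satisfies Hall's Condition.
   Context: A partial latin square of order $n$ is an $n\times n$ array in which some cells are filled with symbols from $\{1,\dots,n\}$, no symbol appearing twice in any row or column. A symbol is missing from a row (column) if it does not appear in a filled cell of that row (column). A cell supports $\sigma$ if it contains $\sigma$, or it is empty and $\sigma$ is missing from both its row and its column. A set of cells is independent if no two lie in the same row or column; an independent set for $\sigma$ is an independent set all of whose cells support $\sigma$. For a set $T$ of cells, $\alpha(\sigma,T)$ is the maximum size of a subset of $T$ that is an independent set for $\sigma$. $P$ satisfies Hall's Condition if $\sum_{\sigma=1}^n\alpha(\sigma,T)\ge|T|$ for every set $T$ of cells of $P$. *)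

(* Defs.v *)
From mathcomp Require Import all_boot all_order all_algebra.

Set Implicit Arguments.
Unset Strict Implicit.
Unset Printing Implicit Defensive.

(* Rows, columns and symbols are all indexed by 'I_n, that is, by {0, ..., n-1}
   instead of {1, ..., n}.  A cell is a pair (row, column); [None] marks an
   empty cell. *)
Definition cell (n : nat) := ('I_n * 'I_n)%type.
Definition partial_array (n : nat) := {ffun cell n -> option 'I_n}.

Definition partial_latin_square (n : nat) (P : partial_array n) : Prop :=
  (forall r c c' s, P (r, c) = Some s -> P (r, c') = Some s -> c = c') /\
  (forall r r' c s, P (r, c) = Some s -> P (r', c) = Some s -> r = r').

Section Hall.
Variables (n : nat) (P : partial_array n).

Definition empty_cell (b : cell n) : bool := P b == None.

Definition missing_from_row (s r : 'I_n) : bool :=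
  [forall c : 'I_n, P (r, c) != Some s].

Definition missing_from_col (s c : 'I_n) : bool :=
  [forall r : 'I_n, P (r, c) != Some s].

Definition supports (b : cell n) (s : 'I_n) : bool :=
  (P b == Some s) ||
  [&& empty_cell b, missing_from_row s b.1 & missing_from_col s b.2].

Definition supported_symbols (b : cell n) : {set 'I_n} :=
  [set s | supports b s].

Definition nu (s : 'I_n) : nat := #|[set b : cell n | P b == Some s]|.

Definition independent (I : {set cell n}) : bool :=
  [forall b in I, forall b' in I,
     (b != b') ==> (b.1 != b'.1) && (b.2 != b'.2)].

Definition independent_for (s : 'I_n) (I : {set cell n}) : bool :=
  independent I && [forall b in I, supports b s].

Definition alpha (s : 'I_n) (T : {set cell n}) : nat :=
  \max_(I : {set cell n} | (I \subset T) && independent_for s I) #|I|.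

Definition Hall_condition : Prop :=
  forall T : {set cell n}, #|T| <= \sum_(s < n) alpha s T.

End Hall.

(* Main.v *)
(* Fix a symbol s and put k = n - nu(s).  The empty cells supporting s lie in the
   subarray formed by the at most k rows and at most k columns missing s.  Cyclic
   diagonals split that subarray into k independent classes, so some class
   contains at least a fraction 1/k of the empty cells of T supporting s.  Adding
   the cells of T filled with s keeps it independent.  Summing the resulting lower
   bounds for alpha(s, T) over s, each cell of T contributes at least 1. *)
Require Import Defs.
From mathcomp Require Import all_boot all_order all_algebra.
Local Open Scope ring_scope.

Set Implicit Arguments.
Unset Strict Implicit.
Unset Printing Implicit Defensive.
Import Order.TTheory GRing.Theory Num.Theory.

Lemma leq_card_disjoint (n : nat) (A B : {set 'I_n}) :
  [disjoint A & B] -> (#|B| <= n - #|A|)%N.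
Proof.
move=> dAB; have leAn : (#|A| <= n)%N by rewrite -[leqRHS]card_ord max_card.
rewrite leq_subRL // -cardsUI (disjoint_setI0 dAB) cards0 addn0.
by rewrite -[leqRHS]card_ord max_card.
Qed.

Lemma independentP (n : nat) (I : {set cell n}) :
  reflect {in I &, forall b b', b.1 = b'.1 \/ b.2 = b'.2 -> b = b'} (independent I).
Proof.
apply: (iffP forall_inP) => [h b b' bI b'I e | h b bI].
  apply/eqP; apply: contraT => ne; move/forall_inP: (h b bI) => /(_ b' b'I).
  by rewrite ne /=; case: e => ->; rewrite eqxx ?andbF.
apply/forall_inP => b' b'I; apply/implyP => ne.
by apply/andP; split; apply: contra ne => /eqP e; apply/eqP; apply: h => //;
  [left | right].
Qed.

Lemma row_inj (n : nat) (P : partial_array n) (hP : partial_latin_square P)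
    (s : 'I_n) :
  {in [set b | P b == Some s] &, injective fst}.
Proof.
move=> [r c] [r' c']; rewrite !inE /= => /eqP h /eqP h' er.
by rewrite -er in h' *; rewrite (hP.1 _ _ _ _ h h').
Qed.

Lemma col_inj (n : nat) (P : partial_array n) (hP : partial_latin_square P)
    (s : 'I_n) :
  {in [set b | P b == Some s] &, injective snd}.
Proof.
move=> [r c] [r' c']; rewrite !inE /= => /eqP h /eqP h' ec.
by rewrite -ec in h' *; rewrite (hP.2 _ _ _ _ h h').
Qed.

Lemma nu_le (n : nat) (P : partial_array n) (hP : partial_latin_square P)
    (s : 'I_n) :
  (nu P s <= n)%N.
Proof. by rewrite /nu -(card_in_imset (row_inj hP (s := s))) -[leqRHS]card_ord max_card. Qed.

(** The occurrences of [s] occupy [nu P s] distinct rows, by [row_inj], and none of these rows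
    misses [s]. *)
Lemma card_missing_rows (n : nat) (P : partial_array n)
    (hP : partial_latin_square P) (s : 'I_n) :
  (#|[set r | missing_from_row P s r]| <= n - nu P s)%N.
Proof.
rewrite /nu -(card_in_imset (row_inj hP (s := s))); apply: leq_card_disjoint.
apply/pred0P => r /=; rewrite !inE; apply/negP => /andP[/imsetP[[r' c]]].
by rewrite inE /= => h -> /forallP /(_ c); rewrite h.
Qed.

Lemma card_missing_cols (n : nat) (P : partial_array n)
    (hP : partial_latin_square P) (s : 'I_n) :
  (#|[set c | missing_from_col P s c]| <= n - nu P s)%N.
Proof.
rewrite /nu -(card_in_imset (col_inj hP (s := s))); apply: leq_card_disjoint.
apply/pred0P => c /=; rewrite !inE; apply/negP => /andP[/imsetP[[r c']]].
by rewrite inE /= => h -> /forallP /(_ r); rewrite h.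
Qed.

(** Pigeonhole: the largest fibre is at least the average one. *)
Lemma leq_card_fiber (T : finType) (k : nat) (A : {set T}) (f : T -> 'I_k.+1) :
  exists j, (#|A| <= k.+1 * #|[set b in A | f b == j]|)%N.
Proof.
exists [arg max_(j > ord0) #|[set b in A | f b == j]|].
case: arg_maxnP => //= j _ jmax.
rewrite -sum1_card (partition_big f xpredT) //= -[X in (_ <= X * _)%N]card_ord -sum_nat_const.
apply: leq_sum => i _; rewrite sum1dep_card.
by apply: (leq_trans _ (jmax i isT)); apply/eq_leq/eq_card => b; rewrite !inE.
Qed.

Lemma large_diagonal (n k : nat) (R C : {set 'I_n}) (A : {set cell n}) :
  (#|R| <= k)%N -> (#|C| <= k)%N -> A \subset setX R C ->
  exists I : {set cell n},
    [/\ I \subset A, independent I & (#|A| <= k * #|I|)%N].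
Proof.
(* For [k = 0] there are no diagonals to choose from, but [R] is empty and hence so is [A]. *)
move=> Rk Ck /subsetP sA; case: k => [|k] in Rk Ck *.
  exists set0; split; first exact: sub0set.
    by apply/independentP => b b'; rewrite inE.
  rewrite mul0n leqn0 cards_eq0 -subset0; apply/subsetP => b /sA.
  by move: Rk; rewrite leqn0 cards_eq0 => /eqP ->; rewrite !inE.
pose rk (B : {set 'I_n}) x := index x (enum B).
have rk_lt (B : {set _}) x : (#|B| <= k.+1)%N -> x \in B -> (rk B x < k.+1)%N.
  by move=> Bk xB; apply: leq_trans Bk; rewrite cardE index_mem mem_enum.
have rk_inj (B : {set _}) x y :
    x \in B -> y \in B -> rk B x = rk B y -> x = y.
  by move=> xB yB; apply: (index_inj x); rewrite mem_enum.
(* The cyclic diagonal of a cell, with rows and columns numbered by their positions in [R] and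
   [C]. *)
pose d (b : cell n) : 'I_k.+1 := inord ((rk R b.1 + rk C b.2) %% k.+1).
have dE (b b' : cell n) : d b = d b' ->
    rk R b.1 + rk C b.2 = rk R b'.1 + rk C b'.2 %[mod k.+1].
  by move/(congr1 val); rewrite /= !inordK ?ltn_pmod.
have [j Aj] := leq_card_fiber A d.
exists [set b in A | d b == j]; split=> //.
  by apply/subsetP => b; rewrite inE => /andP[].
apply/independentP => -[r c] [r' c']; rewrite !inE /= => /andP[bA /eqP db].
case/andP=> b'A /eqP db' e.
move: (dE _ _ (etrans db (esym db'))) => /= {db db'}.
have /setXP[/= rR cC] := sA _ bA; have /setXP[/= r'R c'C] := sA _ b'A.
(* The shared coordinate cancels from the congruence; the other two ranks are below the modulus, so
   they are equal. *)
case: e => <- /eqP; [rewrite eqn_modDl | rewrite eqn_modDr];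
  by rewrite !modn_small ?rk_lt // => /eqP /rk_inj ->.
Qed.

(** The bound is written as a sum of weights over the cells of [T], so that summing over [s] allows
    the order of summation to be exchanged. *)
Lemma alpha_ge (n : nat) (P : partial_array n) (hP : partial_latin_square P)
    (s : 'I_n) (T : {set cell n}) :
  \sum_(b in T) ((P b == Some s)%:R +
     (empty_cell P b && supports P b s)%:R / (n%:R - (nu P s)%:R))
  <= (alpha P s T)%:R :> rat.
Proof.
pose F := [set b in T | P b == Some s].
pose E := [set b in T | empty_cell P b && supports P b s].
have Emiss b : b \in E -> [/\ P b = None, missing_from_row P s b.1 &
                              missing_from_col P s b.2].
  by rewrite inE /supports /empty_cell => /and3P[_ /eqP ->] /= /andP[].
have [|I [IE indI leEI]] := large_diagonal (A := E)
    (card_missing_rows hP s) (card_missing_cols hP s).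
  by apply/subsetP => b /Emiss[_ hr hc]; rewrite !inE hr hc.
(* A cell of [F] puts [s] in its row and column, whereas cells of [I] lie in rows and columns
   missing [s]. *)
have FI b b' : b \in F -> b' \in I -> ~ (b.1 = b'.1 \/ b.2 = b'.2).
  case: b b' => r c [r' c']; rewrite inE /= => /andP[_ /eqP h].
  case/(subsetP IE)/Emiss => _ /forallP /= /(_ c) hr /forallP /(_ r) hc.
  by case=> e; [move: hr | move: hc]; rewrite -e h eqxx.
have dFI : [disjoint F & I].
  by apply/pred0P => b /=; apply/negP => /andP[bF bI]; case: (FI b b bF bI); left.
have ind : independent_for P s (F :|: I).
  apply/andP; split; last first.
    apply/forall_inP => b; rewrite in_setU => /orP[].
      by rewrite inE /supports => /andP[_ ->].
    by move/(subsetP IE); rewrite inE => /and3P[].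
  apply/independentP => b b'; rewrite !in_setU => /orP[] hb /orP[] hb'.
  - move: hb hb'; rewrite !inE => /andP[_ hb] /andP[_ hb'].
    by case=> e; [apply: (row_inj hP (s := s)) | apply: (col_inj hP (s:=s))];
      rewrite ?inE.
  - by move/(FI _ _ hb hb').
  - by move=> e; case: (FI _ _ hb' hb); case: e => ->; [left | right].
  - by move/independentP: indI; apply.
have le_alpha : (#|F| + #|I| <= alpha P s T)%N.
  rewrite -cardsUI (disjoint_setI0 dFI) cards0 addn0.
  apply: (leq_bigmax_cond (F := fun I : {set cell n} => #|I|)).
  rewrite ind andbT subUset; apply/andP; split.
    by apply/subsetP => b; rewrite inE => /andP[].
  by apply: subset_trans IE _; apply/subsetP => b; rewrite inE => /andP[].
have cardR (p : pred (cell n)) :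
    \sum_(b in T) (p b)%:R = #|[set b in T | p b]|%:R :> rat.
  rewrite -sum1_card natr_sum (eq_bigl (fun b => (b \in T) && p b)).
    by rewrite big_mkcondr; apply: eq_bigr => b _; case: (p b).
  by move=> b; rewrite inE.
rewrite big_split -mulr_suml /= !cardR -natrB ?nu_le //.
apply: (@le_trans _ _ (#|F| + #|I|)%:R); last by rewrite ler_nat.
rewrite natrD lerD2l.
(* If [s] occurs [n] times the denominator is 0; its inverse is 0 by convention, so the term
   vanishes. *)
have [k0|k0] := posnP (n - nu P s)%N; first by rewrite k0 invr0 mulr0.
by rewrite ler_pdivrMr ?ltr0n // -natrM ler_nat mulnC.
Qed.

Theorem theorem7 (n : nat) (P : partial_array n)
    (hP : partial_latin_square P)
    (hS : forall b : cell n, empty_cell P b ->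
       1 <= \sum_(s in supported_symbols P b)
              1 / (n%:R - (nu P s)%:R) :> rat) :
  Hall_condition P.
Proof.
move=> T; rewrite -(ler_nat rat) natr_sum.
apply: le_trans (ler_sum _ (fun s _ => alpha_ge hP s T)).
rewrite exchange_big /= -sum1_card natr_sum; apply: ler_sum => b _.
rewrite big_split /= /empty_cell; case Pb: (P b) => [s|] /=.
  (* A filled cell gets weight 1 from its own symbol, and the remaining terms are nonnegative. *)
  rewrite (bigD1 s) //= eqxx -addrA lerDl addr_ge0 ?sumr_ge0 // => i _.
  by rewrite mul0r.
(* For an empty cell only the fractional weights remain, and they add up to the sum in [hS]. *)
rewrite big1 // add0r.
apply: (le_trans (hS b _)); first by rewrite /empty_cell Pb.
rewrite big_mkcond; apply: ler_sum => s _; rewrite inE.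
by case: (supports P b s); rewrite ?mul0r.
Qed.
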